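(* Let $\beta\in\mathbb{R}$, $\rho_-,\rho_+>0$ and $u_-,u_+\in\mathbb{R}$ with $u_-<u_+<u_-+2$. For $\gamma\in(1,2)$, let $(\rho_\gamma,u_\gamma)$ be the Riemann solution containing two rarefaction waves of $$\rho_t+(\rho u)_x=0,\qquad u_t+\Big(\frac{u^2}{2}+\frac{\gamma-1}{4}\rho^{\gamma-1}\Big)_x=\beta$$ with initial data $(\rho,u)(0,x)=(\rho_-,u_-)$ for $x<0$ and $(\rho_+,u_+)$ for $x>0$ (described explicitly in the context, with intermediate density $\rho_{*\gamma}$). Then, as $\gamma\to1^+$, the vacuum state occurs, i.e. $\rho_{*\gamma}\to0$, and the two rarefaction waves become two contact discontinuities connecting the states $(\rho_\pm,u_\pm+\beta t)$ with the vacuum $\rho=0$, which form a vacuum solution, with the same initial data, of the pressureless system $$\rho_t+(\rho u)_x=0,\qquad u_t+\Big(\frac{u^2}{2}\Big)_x=\beta .$$ Explicitly, for every $t>0$, as $\gamma\to1^+$: $(\rho_\gamma,u_\gamma)(t,x)\to(\rho_-,u_-+\beta t)$ if $x<u_-t+\tfrac12\beta t^2$; $\rho_\gamma(t,x)\to0$ if $u_-t+\tfrac12\beta t^2<x<u_+t+\tfrac12\beta t^2$; and $(\rho_\gamma,u_\gamma)(t,x)\to(\rho_+,u_++\beta t)$ if $x>u_+t+\tfrac12\beta t^2$.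
   Context: Two-rarefaction-wave Riemann solution. Consider those $\gamma\in(1,2)$ with $$\big|\rho_-^{\frac{\gamma-1}{2}}-\rho_+^{\frac{\gamma-1}{2}}\big|<u_+-u_-<\rho_-^{\frac{\gamma-1}{2}}+\rho_+^{\frac{\gamma-1}{2}};$$ when $u_-<u_+<u_-+2$ this holds for all $\gamma>1$ sufficiently close to $1$. For such $\gamma$ the intermediate state $(\rho_{*\gamma},v_{*\gamma})$, $0<\rho_{*\gamma}\le\min\{\rho_-,\rho_+\}$, is determined by $$v_{*\gamma}+\rho_{*\gamma}^{\frac{\gamma-1}{2}}=u_-+\rho_-^{\frac{\gamma-1}{2}},\qquad v_{*\gamma}-\rho_{*\gamma}^{\frac{\gamma-1}{2}}=u_+-\rho_+^{\frac{\gamma-1}{2}} .$$ Put $\xi=(x-\tfrac12\beta t^2)/t$ and $\mu_1(\rho,v)=v-\frac{\gamma-1}{2}\rho^{\frac{\gamma-1}{2}}$, $\mu_2(\rho,v)=v+\frac{\gamma-1}{2}\rho^{\frac{\gamma-1}{2}}$ (so the characteristic speeds are $\mu_i+\beta t$). The Riemann solution is $(\rho_\gamma,u_\gamma)=(\rho,v+\beta t)$, where for $t>0$ the pair $(\rho,v)(t,x)$ depends only on $\xi$ and - $(\rho,v)=(\rho_-,u_-)$ for $\xi\le\mu_1(\rho_-,u_-)$; - (1-rarefaction wave $R_1^\gamma$) for $\mu_1(\rho_-,u_-)\le\xi\le\mu_1(\rho_{*\gamma},v_{*\gamma})$, $(\rho,v)$ is determined by $\mu_1(\rho,v)=\xi$,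 $v+\rho^{\frac{\gamma-1}{2}}=u_-+\rho_-^{\frac{\gamma-1}{2}}$, $\rho_{*\gamma}\le\rho\le\rho_-$; - $(\rho,v)=(\rho_{*\gamma},v_{*\gamma})$ for $\mu_1(\rho_{*\gamma},v_{*\gamma})\le\xi\le\mu_2(\rho_{*\gamma},v_{*\gamma})$; - (2-rarefaction wave $R_2^\gamma$) for $\mu_2(\rho_{*\gamma},v_{*\gamma})\le\xi\le\mu_2(\rho_+,u_+)$, $(\rho,v)$ is determined by $\mu_2(\rho,v)=\xi$, $v-\rho^{\frac{\gamma-1}{2}}=u_+-\rho_+^{\frac{\gamma-1}{2}}$, $\rho_{*\gamma}\le\rho\le\rho_+$; - $(\rho,v)=(\rho_+,u_+)$ for $\xi\ge\mu_2(\rho_+,u_+)$. Vacuum solution of the pressureless system (for $u_-<u_+$): the two contact discontinuities are the curves $x=u_\pm t+\tfrac12\beta t^2$; the state is $(\rho_-,u_-+\beta t)$ to the left of $x=u_-t+\tfrac12\beta t^2$, vacuum ($\rho=0$, velocity left unspecified) between the two curves, and $(\rho_+,u_++\beta t)$ to the right of $x=u_+t+\tfrac12\beta t^2$. *)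

(* Defs.v *)
From mathcomp Require Import all_boot all_order all_algebra.
From mathcomp Require Import all_classical all_reals all_analysis.

Set Implicit Arguments.
Unset Strict Implicit.
Unset Printing Implicit Defensive.

Import Order.TTheory GRing.Theory Num.Theory.
Import numFieldNormedType.Exports.

Local Open Scope classical_set_scope.
Local Open Scope ring_scope.

Section RiemannProblem.
Context {R : realType}.
Implicit Types (beta gamma rhoL uL rhoR uR : R) (rho u : R -> R -> R).

(* Functions of time and space are written f t x. *)
Definition balance_law (U F : R -> R -> R) (S t x : R) : Prop :=
  [/\ derivable (fun s => U s x) t 1, derivable (F t) x 1 &
      derive1 (fun s => U s x) t + derive1 (F t) x = S].

Definition mass_law rho u (t x : R) : Prop :=
  balance_law rho (fun t x => rho t x * u t x) 0 t x.

(* The term p is (gamma - 1) / 4 * rho `^ (gamma - 1) in the isentropic system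
   and 0 in the pressureless one. *)
Definition velocity_law (p : R -> R) beta rho u (t x : R) : Prop :=
  balance_law u (fun t x => u t x ^+ 2 / 2 + p (rho t x)) beta t x.

Definition isentropic_term gamma (r : R) : R :=
  (gamma - 1) / 4 * r `^ (gamma - 1).

Definition pressureless_term (r : R) : R := 0.

Definition riemann_data rhoL uL rhoR uR rho u : Prop :=
  (forall x : R, x < 0 ->
    [/\ rho 0 x = rhoL, u 0 x = uL,
        rho t x @[t --> 0^'+] --> rhoL & u t x @[t --> 0^'+] --> uL]) /\
  (forall x : R, 0 < x ->
    [/\ rho 0 x = rhoR, u 0 x = uR,
        rho t x @[t --> 0^'+] --> rhoR & u t x @[t --> 0^'+] --> uR]).

Definition two_rarefaction_range rhoL uL rhoR uR gamma : Prop :=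
  let c (r : R) := r `^ ((gamma - 1) / 2) in
  [/\ 1 < gamma < 2, `|c rhoL - c rhoR| < uR - uL & uR - uL < c rhoL + c rhoR].

Definition intermediate_state gamma rhoL uL rhoR uR (rhoS vS : R) : Prop :=
  let c (r : R) := r `^ ((gamma - 1) / 2) in
  [/\ 0 < rhoS <= Num.min rhoL rhoR,
      vS + c rhoS = uL + c rhoL & vS - c rhoS = uR - c rhoR].

Definition mu1 gamma (r v : R) : R :=
  v - (gamma - 1) / 2 * r `^ ((gamma - 1) / 2).

Definition mu2 gamma (r v : R) : R :=
  v + (gamma - 1) / 2 * r `^ ((gamma - 1) / 2).

Variant wave_pattern gamma rhoL uL rhoR uR (rhoS vS xi r v : R) : Prop :=
| LeftState of xi <= mu1 gamma rhoL uL & r = rhoL & v = uL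
| Rarefaction1 of mu1 gamma rhoL uL <= xi <= mu1 gamma rhoS vS &
    mu1 gamma r v = xi &
    v + r `^ ((gamma - 1) / 2) = uL + rhoL `^ ((gamma - 1) / 2) &
    rhoS <= r <= rhoL
| MiddleState of mu1 gamma rhoS vS <= xi <= mu2 gamma rhoS vS &
    r = rhoS & v = vS
| Rarefaction2 of mu2 gamma rhoS vS <= xi <= mu2 gamma rhoR uR &
    mu2 gamma r v = xi &
    v - r `^ ((gamma - 1) / 2) = uR - rhoR `^ ((gamma - 1) / 2) &
    rhoS <= r <= rhoR
| RightState of mu2 gamma rhoR uR <= xi & r = rhoR & v = uR.

Definition similarity beta (t x : R) : R := (x - beta / 2 * t ^+ 2) / t.

(* The solution is only Lipschitz, so that the equations are required off the
   four rays bounding the waves.  They follow there from [trs_pattern]. *)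
Record two_rarefaction_solution beta gamma rhoL uL rhoR uR (rhoS vS : R) rho u
  : Prop := TwoRarefactionSolution {
  trs_data : riemann_data rhoL uL rhoR uR rho u;
  trs_pattern : forall t x : R, 0 < t ->
    wave_pattern gamma rhoL uL rhoR uR rhoS vS
      (similarity beta t x) (rho t x) (u t x - beta * t);
  trs_laws : forall t x : R, 0 < t ->
    similarity beta t x \notin [:: mu1 gamma rhoL uL; mu1 gamma rhoS vS;
                                   mu2 gamma rhoS vS; mu2 gamma rhoR uR] ->
    mass_law rho u t x /\
    velocity_law (isentropic_term gamma) beta rho u t x }.

Definition contact_curve beta (v t : R) : R := v * t + beta / 2 * t ^+ 2.

(* Rankine-Hugoniot condition for the mass equation across x = s t.  A
   discontinuity of the pressureless system is a contact when its speed is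
   the (double) characteristic speed u of the adjacent states; as u has no
   meaning in the vacuum, this is asked on the sides where rho is nonzero. *)
Definition contact_discontinuity rho u (s : R -> R) (t : R) : Prop :=
  exists sigma rl rr ml mr : R,
  [/\ is_derive t 1 s sigma,
      rho t y @[y --> (s t)^'-] --> rl /\ rho t y @[y --> (s t)^'+] --> rr,
      rho t y * u t y @[y --> (s t)^'-] --> ml /\
      rho t y * u t y @[y --> (s t)^'+] --> mr,
      sigma * (rr - rl) = mr - ml &
      (rl != 0 -> u t y @[y --> (s t)^'-] --> sigma) /\
      (rr != 0 -> u t y @[y --> (s t)^'+] --> sigma)].

Record vacuum_solution beta rhoL uL rhoR uR rho u : Prop := VacuumSolution {
  vac_data : riemann_data rhoL uL rhoR uR rho u;
  vac_left : forall t x : R, 0 < t -> x < contact_curve beta uL t ->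
    rho t x = rhoL /\ u t x = uL + beta * t;
  vac_middle : forall t x : R, 0 < t ->
    contact_curve beta uL t < x < contact_curve beta uR t -> rho t x = 0;
  vac_right : forall t x : R, 0 < t -> contact_curve beta uR t < x ->
    rho t x = rhoR /\ u t x = uR + beta * t;
  vac_laws : forall t x : R, 0 < t ->
    x != contact_curve beta uL t -> x != contact_curve beta uR t ->
    mass_law rho u t x /\
    (rho t x != 0 -> velocity_law pressureless_term beta rho u t x);
  vac_contacts : forall t : R, 0 < t ->
    contact_discontinuity rho u (contact_curve beta uL) t /\
    contact_discontinuity rho u (contact_curve beta uR) t }.

Definition vacuum_density beta rhoL uL rhoR uR (t x : R) : R :=
  if x <= contact_curve beta uL t then rhoL
  else if x < contact_curve beta uR t then 0 else rhoR.

(* The velocity in the vacuum is an arbitrary function w. *)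
Definition vacuum_velocity beta uL uR (w : R -> R -> R) (t x : R) : R :=
  if x <= contact_curve beta uL t then uL + beta * t
  else if x < contact_curve beta uR t then w t x else uR + beta * t.

End RiemannProblem.

(* Main.v *)
Require Import Defs.
From mathcomp Require Import all_boot all_order all_algebra.
From mathcomp Require Import all_classical all_reals all_analysis.
From mathcomp Require Import lra ring.

(** Put e = (gamma - 1) / 2 and c(r) = r `^ e, so that c(r) --> 1 for every
    fixed r > 0 as e --> 0.  On the 1-wave v + c(r) = uL + c(rhoL) and
    v - e c(r) = xi give c(r) <= uL + c(rhoL) - xi; on the 2-wave, likewise,
    c(r) <= xi - uR + c(rhoR); in the middle state c(r) is the average of these
    two bounds.  For uL < xi < uR both bounds have a limit < 1, and
    c(r) <= q < 1 for all small e forces r --> 0.  The two waves open at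
    uL - e c(rhoL) --> uL and close at uR + e c(rhoR) --> uR. *)

Import Order.TTheory GRing.Theory Num.Theory.
Import numFieldNormedType.Exports.
Local Open Scope classical_set_scope.
Local Open Scope ring_scope.

Set Implicit Arguments.
Unset Strict Implicit.

Section VanishingPressure.
Context {R : realType}.
Implicit Types (beta gamma rhoL uL rhoR uR rhoS vS xi r v t x : R).

(** * Powers with exponent e = (gamma - 1) / 2 as gamma decreases to 1 *)

Lemma cvg_half_at1 : (gamma - 1) / 2 @[gamma --> (1 : R)^'+] --> (0 : R).
Proof.
apply: cvg_at_right_filter.
have -> : (0 : R) = (1 - 1) / 2 by rewrite subrr mul0r.
by apply: cvgMl; apply: cvgB; [exact: cvg_id|exact: cvg_cst].
Qed.

Lemma cvg_powR_half_at1 (a : R) : 0 < a ->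
  a `^ ((gamma - 1) / 2) @[gamma --> (1 : R)^'+] --> (1 : R).
Proof.
move=> a0.
rewrite [X in X @ _](_ : _ = fun g => expR ((g - 1) / 2 * ln a)); last first.
  by apply/funext => g; rewrite /powR gt_eqF.
rewrite -[X in _ --> X]expR0 -(mul0r (ln a)).
have lim : (g - 1) / 2 * ln a @[g --> (1 : R)^'+] --> 0 * ln a.
  by apply: cvgMl; exact: cvg_half_at1.
exact: (cvg_comp _ _ lim (@continuous_expR R _)).
Qed.

(** If [r gamma >= eps], monotonicity of the power would give c(eps) <= c(r) <= q, whereas c(eps)
    tends to 1 > q for each fixed eps > 0. *)
Lemma cvg0_powR_half_le (r : R -> R) (q : R) : q < 1 ->
  (\forall gamma \near 1^'+,
     0 <= r gamma /\ r gamma `^ ((gamma - 1) / 2) <= q) ->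
  r gamma @[gamma --> 1^'+] --> 0.
Proof.
move=> q1 rq; apply/cvgr0Pnorm_lt => eps eps0.
near=> g.
have [r0 rgq] : 0 <= r g /\ r g `^ ((g - 1) / 2) <= q by near: g.
rewrite ger0_norm// ltNge; apply/negP => epsr.
have : q < eps `^ ((g - 1) / 2).
  by near: g; exact: (cvgr_gt _ (cvg_powR_half_at1 eps0) _ q1).
apply/negP; rewrite -leNgt (le_trans _ rgq)//.
apply: ge0_ler_powR; rewrite ?nnegrE// ?(ltW eps0)//.
rewrite divr_ge0// subr_ge0 ltW//; near: g; exact: nbhs_right_gt.
Unshelve. all: by end_near. Qed.

(** * Structure of the wave pattern at a fixed gamma *)

Section FixedGamma.
Variables (gamma rhoL uL rhoR uR rhoS vS : R).
Hypotheses (gamma_gt1 : 1 < gamma).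
Hypothesis state : intermediate_state gamma rhoL uL rhoR uR rhoS vS.
Local Notation c r := (r `^ ((gamma - 1) / 2)).

Let e_gt0 : 0 < (gamma - 1) / 2.
Proof. by rewrite divr_gt0// subr_gt0. Qed.

Lemma intermediate_sonic : c rhoS = (uL - uR + c rhoL + c rhoR) / 2.
Proof. by case: state => _; lra. Qed.

(** By the two state equations the successive gaps are (1 + e)(c(rhoL) - c(rhoS)), 2 e c(rhoS) and
    (1 + e)(c(rhoR) - c(rhoS)); they are nonnegative since c is monotone and [rhoS] is at most both
    outer densities. *)
Lemma intermediate_speeds :
  [/\ mu1 gamma rhoL uL <= mu1 gamma rhoS vS,
      mu1 gamma rhoS vS <= mu2 gamma rhoS vS &
      mu2 gamma rhoS vS <= mu2 gamma rhoR uR].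
Proof.
case: state => /andP[rS0]; rewrite le_min => /andP[rSL rSR] eL eR.
have cmono a : rhoS <= a -> c rhoS <= c a.
  move=> Sa; apply: ge0_ler_powR; rewrite ?nnegrE// ?ltW//.
  exact: lt_le_trans Sa.
have cL := cmono _ rSL; have cR := cmono _ rSR.
have cS := powR_ge0 rhoS ((gamma - 1) / 2).
have eL' := ler_wpM2l (ltW e_gt0) cL; have eR' := ler_wpM2l (ltW e_gt0) cR.
have eS' := mulr_ge0 (ltW e_gt0) cS.
by rewrite /mu1 /mu2; split; lra.
Qed.

Variables (xi r v : R).
Hypothesis pattern : wave_pattern gamma rhoL uL rhoR uR rhoS vS xi r v.

(** The clauses of the pattern overlap at their closed ends; the strict bound on [xi] and the order
    of the four speeds exclude all but one. *)
Lemma wave_pattern_left : xi < mu1 gamma rhoL uL -> r = rhoL /\ v = uL.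
Proof.
case: intermediate_speeds => ? ? ? ?.
case: pattern => [|/andP[]|/andP[]|/andP[]|] *; by [split|exfalso; lra].
Qed.

Lemma wave_pattern_right : mu2 gamma rhoR uR < xi -> r = rhoR /\ v = uR.
Proof.
case: intermediate_speeds => ? ? ? ?.
case: pattern => [|/andP[]|/andP[]|/andP[]|] *; by [split|exfalso; lra].
Qed.

(** The maximum serves all three inner clauses at once, so it need not be known which of them holds
    at [xi] as gamma varies. *)
Lemma wave_pattern_fan : mu1 gamma rhoL uL < xi < mu2 gamma rhoR uR ->
  0 <= r /\ c r <= Num.max (uL + c rhoL - xi) (xi - uR + c rhoR).
Proof.
have rS0 : 0 < rhoS by case: state => /andP[].
move=> /andP[xiL xiR].
(* In either wave (1 + e) c(r) equals the corresponding bound exactly; the inequality comes from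
   dropping e c(r) >= 0. *)
have cr := mulr_ge0 (ltW e_gt0) (powR_ge0 r ((gamma - 1) / 2)).
rewrite le_max.
case: pattern => [|_ m1 eL /andP[? _]|_ -> _|_ m2 eR /andP[? _]|].
- by move=> *; exfalso; lra.
- split; first by lra.
  by apply/orP; left; move: m1; rewrite /mu1; lra.
- split; first exact: ltW.
  (* The two bounds have a sum independent of [xi], namely 2 c(rhoS); their mean is at most the
     larger one. *)
  rewrite intermediate_sonic; apply/orP.
  have [|] := leP (xi - uR + c rhoR) (uL + c rhoL - xi); [left|right]; lra.
- split; first by lra.
  by apply/orP; right; move: m2; rewrite /mu2; lra.
- by move=> *; exfalso; lra.
Qed.

End FixedGamma.

(** * Limits of the admissible range, the outer wave edges and the sonic bounds *)

Section Limits.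
Variables (rhoL rhoR uL uR : R).
Hypotheses (rhoL_gt0 : 0 < rhoL) (rhoR_gt0 : 0 < rhoR).

(** With both powers tending to 1, the conditions on [uR - uL] become 0 < uR - uL < 2 in the limit,
    and strict inequalities persist near it. *)
Lemma near_two_rarefaction_range : uL < uR -> uR < uL + 2 ->
  \forall gamma \near 1^'+, two_rarefaction_range rhoL uL rhoR uR gamma.
Proof.
move=> uLR uR2.
have cL := cvg_powR_half_at1 rhoL_gt0; have cR := cvg_powR_half_at1 rhoR_gt0.
near=> g; split.
- apply/andP; split; near: g; first exact: nbhs_right_gt.
  by apply: nbhs_right_lt; lra.
- near: g.
  apply: (cvgr_lt (0 : R)); last by rewrite subr_gt0.
  rewrite -[X in _ --> X](normr0 R) -(subrr (1 : R)).
  by apply: cvg_norm; apply: cvgB.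
- near: g; apply: (cvgr_gt (1 + 1 : R)); first exact: cvgD.
  by lra.
Unshelve. all: by end_near. Qed.

Lemma cvg_mu1_at1 : mu1 gamma rhoL uL @[gamma --> 1^'+] --> uL.
Proof.
rewrite -[X in _ --> X]subr0 -(mul0r (1 : R)).
apply: cvgB; first exact: cvg_cst.
by apply: cvgM; [exact: cvg_half_at1|exact: cvg_powR_half_at1].
Qed.

Lemma cvg_mu2_at1 : mu2 gamma rhoR uR @[gamma --> 1^'+] --> uR.
Proof.
rewrite -[X in _ --> X]addr0 -(mul0r (1 : R)).
apply: cvgD; first exact: cvg_cst.
by apply: cvgM; [exact: cvg_half_at1|exact: cvg_powR_half_at1].
Qed.

(** The hypothesis puts the limits [1 + uL - xi] and [1 + xi - uR] of the two bounds strictly below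
    [q]; some q < 1 satisfies it exactly when uL < xi < uR. *)
Lemma near_fan_bound xi q : 1 + uL - q < xi < uR + q - 1 ->
  \forall gamma \near 1^'+,
    Num.max (uL + rhoL `^ ((gamma - 1) / 2) - xi)
            (xi - uR + rhoR `^ ((gamma - 1) / 2)) <= q.
Proof.
move=> /andP[Lq Rq].
have cL := cvgr_lt _ (cvg_powR_half_at1 rhoL_gt0) (q + xi - uL).
have cR := cvgr_lt _ (cvg_powR_half_at1 rhoR_gt0) (q - xi + uR).
near=> g.
have : rhoL `^ ((g - 1) / 2) < q + xi - uL by near: g; apply: cL; lra.
have : rhoR `^ ((g - 1) / 2) < q - xi + uR by near: g; apply: cR; lra.
by rewrite ge_max => *; apply/andP; split; lra.
Unshelve. all: by end_near. Qed.

End Limits.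

(** * Contact curves, and balance laws for locally constant flux *)

Lemma contact_curveP beta (v t : R) :
  is_derive t 1 (contact_curve beta v) (v + beta * t).
Proof.
rewrite /contact_curve; apply: is_derive_eq.
by rewrite /GRing.scale /=; field.
Qed.

Lemma contact_curve_continuous beta (v : R) : continuous (contact_curve beta v).
Proof.
move=> t; have /@ex_derive := contact_curveP beta v t.
by move=> /derivable1_diffP/differentiable_continuous.
Qed.

Lemma similarity_lt beta (v t x : R) : 0 < t ->
  (similarity beta t x < v) = (x < contact_curve beta v t).
Proof. by move=> t0; rewrite /similarity ltr_pdivrMr// ltrBlDr. Qed.

Lemma similarity_gt beta (v t x : R) : 0 < t ->
  (v < similarity beta t x) = (contact_curve beta v t < x).
Proof. by move=> t0; rewrite /similarity ltr_pdivlMr// ltrBrDr. Qed.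

(** One criterion for both equations: [S] is 0 for the mass and [beta] for the velocity, which gains
    beta per unit of time but is uniform in space in each outer state. *)
Lemma balance_law_affine (U F : R -> R -> R) (S t x a k : R) :
  (\forall s \near t, U s x = a + S * s) -> (\forall y \near x, F t y = k) ->
  balance_law U F S t x.
Proof.
move=> nU nF.
have dU : is_derive t 1 (fun s => U s x) S.
  apply: (near_eq_is_derive (f := fun s => a + S * s)).
    by apply: filterS nU => s ->.
  by apply: is_derive_eq; rewrite /GRing.scale /=; ring.
have dF : is_derive x 1 (F t) 0.
  apply: (near_eq_is_derive (f := cst k)).
  by apply: filterS nF => y ->.
split; [exact: ex_derive|exact: ex_derive|].
by rewrite !derive1E !derive_val addr0.
Qed.


Lemma near_lt_curve beta (v t x : R) : x < contact_curve beta v t ->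
  \forall s \near t, x < contact_curve beta v s.
Proof. exact: cvgr_gt (@contact_curve_continuous _ _ _) _. Qed.

Lemma near_gt_curve beta (v t x : R) : contact_curve beta v t < x ->
  \forall s \near t, contact_curve beta v s < x.
Proof. exact: cvgr_lt (@contact_curve_continuous _ _ _) _. Qed.

Lemma contact_curve0 beta (v : R) : contact_curve beta v 0 = 0.
Proof. by rewrite /contact_curve expr0n !mulr0 addr0. Qed.

(** * The vacuum solution of the pressureless system *)

Section Vacuum.
Variables (beta rhoL uL rhoR uR : R) (w : R -> R -> R).
Hypothesis uL_lt_uR : uL < uR.
Local Notation curve v := (contact_curve beta v).
Local Notation rho := (vacuum_density beta rhoL uL rhoR uR).
Local Notation u := (vacuum_velocity beta uL uR w).

Lemma contact_curve_lt t : 0 < t -> curve uL t < curve uR t.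
Proof. by move=> t0; rewrite /contact_curve ltrD2r ltr_pM2r. Qed.

Lemma vacuum_at_left t x : x < curve uL t ->
  rho t x = rhoL /\ u t x = uL + beta * t.
Proof. by rewrite /vacuum_density /vacuum_velocity => /ltW ->. Qed.

Lemma vacuum_at_middle t x : curve uL t < x < curve uR t -> rho t x = 0.
Proof. by rewrite /vacuum_density => /andP[xL ->]; rewrite leNgt xL. Qed.

(** For t < 0 the curves would be in the opposite order, and the test against the left curve, made
    first, could succeed. The case t = 0 is included for the initial data. *)
Lemma vacuum_at_right t x : 0 <= t -> curve uR t < x ->
  rho t x = rhoR /\ u t x = uR + beta * t.
Proof.
move=> t0 xR; have xL : curve uL t < x.
  by apply: le_lt_trans xR; rewrite /contact_curve lerD2r ler_wpM2r// ltW.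
by rewrite /vacuum_density /vacuum_velocity leNgt xL /= ltNge (ltW xR).
Qed.

(** Both curves are continuous and start at the origin, so a fixed x <> 0 stays in one outer state
    for all small t. *)
Lemma vacuum_data : riemann_data rhoL uL rhoR uR rho u.
Proof.
have at0 (v : R) : v = v + beta * 0 by rewrite mulr0 addr0.
have cvgu (v : R) : v + beta * t @[t --> 0^'+] --> v.
  rewrite [X in _ --> X]at0; apply: cvg_at_right_filter.
  by apply: cvgD; [exact: cvg_cst|apply: cvgMr; exact: cvg_id].
split=> x x0.
- have [-> ->] : rho 0 x = rhoL /\ u 0 x = uL + beta * 0.
    by apply: vacuum_at_left; rewrite contact_curve0.
  have xL : \forall t \near 0^'+, rho t x = rhoL /\ u t x = uL + beta * t.
    near=> t; apply: vacuum_at_left; near: t.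
    by apply: cvg_within; apply: near_lt_curve; rewrite contact_curve0.
  split=> //.
  + by apply: cvg_near_cst; apply: filterS xL => t [].
  + apply: cvg_trans (cvgu uL); apply: near_eq_cvg.
    by apply: filterS xL => t [].
- have [-> ->] : rho 0 x = rhoR /\ u 0 x = uR + beta * 0.
    by apply: vacuum_at_right; rewrite ?contact_curve0.
  have xR : \forall t \near 0^'+, rho t x = rhoR /\ u t x = uR + beta * t.
    near=> t; apply: vacuum_at_right; near: t; first exact: nbhs_right_ge.
    by apply: cvg_within; apply: near_gt_curve; rewrite contact_curve0.
  split=> //.
  + by apply: cvg_near_cst; apply: filterS xR => t [].
  + apply: cvg_trans (cvgu uR); apply: near_eq_cvg.
    by apply: filterS xR => t [].
Unshelve. all: by end_near. Qed.

Lemma constant_state_laws (r v t x : R) :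
  (\forall s \near t, rho s x = r /\ u s x = v + beta * s) ->
  (\forall y \near x, rho t y = r /\ u t y = v + beta * t) ->
  mass_law rho u t x /\ velocity_law pressureless_term beta rho u t x.
Proof.
move=> nt nx; split.
- apply: (balance_law_affine (a := r) (k := r * (v + beta * t))).
    by apply: filterS nt => s [->]; rewrite mul0r addr0.
  by apply: filterS nx => y [-> ->].
- apply: (balance_law_affine (a := v) (k := (v + beta * t) ^+ 2 / 2)).
    by apply: filterS nt => s [_ ->].
  by apply: filterS nx => y [_ ->]; rewrite /pressureless_term addr0.
Qed.

Lemma vacuum_laws_hold t x : 0 < t -> x != curve uL t -> x != curve uR t ->
  mass_law rho u t x /\
  (rho t x != 0 -> velocity_law pressureless_term beta rho u t x).
Proof.
move=> t0 neL neR.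
have [xL|xL] := ltP x (curve uL t).
  have [] // := @constant_state_laws rhoL uL t x.
    by apply: filterS (near_lt_curve xL) => s; exact: vacuum_at_left.
  by apply: filterS (lt_nbhsl xL) => y; exact: vacuum_at_left.
have {}xL : curve uL t < x by rewrite lt_neqAle eq_sym neL.
have [xR|xR] := ltP x (curve uR t).
  (* In the vacuum the premise of the velocity law is false, and the mass law reads 0 = 0 because
     density and flux vanish nearby, whatever [w] is. *)
  rewrite vacuum_at_middle ?xL// eqxx; split=> //.
  apply: (balance_law_affine (a := 0) (k := 0)).
    near=> s; rewrite mul0r addr0; apply: vacuum_at_middle; apply/andP; split.
      by near: s; exact: near_gt_curve.
    by near: s; exact: near_lt_curve.
  near=> y; rewrite vacuum_at_middle ?mul0r//; apply/andP; split; near: y.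
    exact: lt_nbhsr.
  exact: lt_nbhsl.
have {}xR : curve uR t < x by rewrite lt_neqAle eq_sym neR.
have [] // := @constant_state_laws rhoR uR t x.
  near=> s; apply: vacuum_at_right; last by near: s; exact: near_gt_curve.
  by apply: ltW; near: s; exact: lt_nbhsr.
by apply: filterS (lt_nbhsr xR) => y; apply: vacuum_at_right; exact: ltW.
Unshelve. all: by end_near. Qed.

(** Each curve moves with the velocity of its nonvacuum neighbour, so no mass crosses it. On the
    vacuum side the flux is identically 0, so its one-sided limit exists even where [w] has none. *)
Lemma vacuum_contacts t : 0 < t ->
  contact_discontinuity rho u (curve uL) t /\
  contact_discontinuity rho u (curve uR) t.
Proof.
move=> t0; have curves := contact_curve_lt t0; split.
- have nl : \forall y \near (curve uL t)^'-,
      rho t y = rhoL /\ u t y = uL + beta * t.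
    by apply: filterS (nbhs_left_lt _) => y; exact: vacuum_at_left.
  have nr : \forall y \near (curve uL t)^'+, rho t y = 0.
    near=> y; apply: vacuum_at_middle; apply/andP; split; near: y.
      exact: nbhs_right_gt.
    exact: nbhs_right_lt.
  exists (uL + beta * t), rhoL, 0, (rhoL * (uL + beta * t)), 0.
  split; [exact: contact_curveP| | | |].
  + split; apply: cvg_near_cst; last exact: nr.
    by apply: filterS nl => y [].
  + split; apply: cvg_near_cst.
      by apply: filterS nl => y [-> ->].
    by apply: filterS nr => y ->; rewrite mul0r.
  + by rewrite !sub0r mulrN mulrC.
  + rewrite eqxx; split=> // _; apply: cvg_near_cst.
    by apply: filterS nl => y [].
- have nl : \forall y \near (curve uR t)^'-, rho t y = 0.
    near=> y; apply: vacuum_at_middle; apply/andP; split; near: y.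
      exact: nbhs_left_gt.
    exact: nbhs_left_lt.
  have nr : \forall y \near (curve uR t)^'+,
      rho t y = rhoR /\ u t y = uR + beta * t.
    apply: filterS (nbhs_right_gt _) => y.
    by apply: vacuum_at_right; exact: ltW.
  exists (uR + beta * t), 0, rhoR, 0, (rhoR * (uR + beta * t)).
  split; [exact: contact_curveP| | | |].
  + split; apply: cvg_near_cst; first exact: nl.
    by apply: filterS nr => y [].
  + split; apply: cvg_near_cst.
      by apply: filterS nl => y ->; rewrite mul0r.
    by apply: filterS nr => y [-> ->].
  + by rewrite !subr0 mulrC.
  + rewrite eqxx; split=> // _; apply: cvg_near_cst.
    by apply: filterS nr => y [].
Unshelve. all: by end_near. Qed.

Lemma vacuum_solutionP : vacuum_solution beta rhoL uL rhoR uR rho u.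
Proof.
split.
- exact: vacuum_data.
- by move=> t x _; exact: vacuum_at_left.
- by move=> t x _; exact: vacuum_at_middle.
- by move=> t x /ltW; exact: vacuum_at_right.
- exact: vacuum_laws_hold.
- exact: vacuum_contacts.
Qed.

End Vacuum.

End VanishingPressure.

(** * Passage to the limit in the Riemann solutions *)

Unset Implicit Arguments.
Set Strict Implicit.

Theorem theorem4p6 (R : realType) (beta rhoL rhoR uL uR : R)
  (rhoL_gt0 : 0 < rhoL) (rhoR_gt0 : 0 < rhoR)
  (uL_lt_uR : uL < uR) (uR_lt_uL2 : uR < uL + 2)
  (rhoS vS : R -> R) (rho u : R -> R -> R -> R)
  (intermediate : forall gamma,
     two_rarefaction_range rhoL uL rhoR uR gamma ->
     intermediate_state gamma rhoL uL rhoR uR (rhoS gamma) (vS gamma))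
  (solution : forall gamma,
     two_rarefaction_range rhoL uL rhoR uR gamma ->
     two_rarefaction_solution beta gamma rhoL uL rhoR uR
       (rhoS gamma) (vS gamma) (rho gamma) (u gamma)) :
  [/\ \forall gamma \near 1^'+, two_rarefaction_range rhoL uL rhoR uR gamma,
      rhoS gamma @[gamma --> 1^'+] --> 0,
      forall t x : R, 0 < t ->
        [/\ x < uL * t + beta / 2 * t ^+ 2 ->
              rho gamma t x @[gamma --> 1^'+] --> rhoL /\
              u gamma t x @[gamma --> 1^'+] --> uL + beta * t,
            uL * t + beta / 2 * t ^+ 2 < x < uR * t + beta / 2 * t ^+ 2 ->
              rho gamma t x @[gamma --> 1^'+] --> 0 &
            uR * t + beta / 2 * t ^+ 2 < x ->
              rho gamma t x @[gamma --> 1^'+] --> rhoR /\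
              u gamma t x @[gamma --> 1^'+] --> uR + beta * t] &
      forall w : R -> R -> R,
        vacuum_solution beta rhoL uL rhoR uR
          (vacuum_density beta rhoL uL rhoR uR)
          (vacuum_velocity beta uL uR w)].

Proof.
have range :=
  near_two_rarefaction_range rhoL_gt0 rhoR_gt0 uL_lt_uR uR_lt_uL2.
have gt1 : \forall g \near (1 : R)^'+, 1 < g by exact: nbhs_right_gt.
split=> //; last by move=> w; exact: vacuum_solutionP.
(* c(rhoS) is the mean of the two bounds at any [xi], so the midpoint of [uL] and [uR] may be used,
   whichever wave it lies in. Both bounds then tend to 1 - (uR - uL) / 2, and [q] is halfway from
   this limit to 1. *)
- apply: (cvg0_powR_half_le (q := 1 - (uR - uL) / 4)); first by lra.
  have mid := near_fan_bound rhoL_gt0 rhoR_gt0 (uL := uL) (uR := uR)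
    (xi := (uL + uR) / 2) (q := 1 - (uR - uL) / 4).
  near=> g; have gR : two_rarefaction_range rhoL uL rhoR uR g by near: g.
  have st := intermediate _ gR.
  split; first by case: st => /andP[/ltW].
  rewrite (intermediate_sonic st).
  have : Num.max (uL + rhoL `^ ((g - 1) / 2) - (uL + uR) / 2)
      ((uL + uR) / 2 - uR + rhoR `^ ((g - 1) / 2)) <= 1 - (uR - uL) / 4.
    by near: g; apply: mid; apply/andP; split; lra.
  by rewrite ge_max => /andP[? ?]; lra.
- move=> t x t0; set xi := similarity beta t x.
  have u_eq g v : u g t x - beta * t = v -> u g t x = v + beta * t.
    by move=> <-; rewrite subrK.
  split.
  + rewrite -/(contact_curve beta uL t) -similarity_lt// -/xi => xiL.
    (* Once the 1-wave opens to the right of [xi], the solution at this point equals the outer state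
       exactly, so convergence is by eventual constancy. *)
    have left : \forall g \near 1^'+,
        rho g t x = rhoL /\ u g t x = uL + beta * t.
      near=> g; have gR : two_rarefaction_range rhoL uL rhoR uR g by near: g.
      have g1 : 1 < g by near: g.
      have xg : xi < mu1 g rhoL uL.
        by near: g; exact: cvgr_gt (cvg_mu1_at1 rhoL_gt0) _ xiL.
      have pat := trs_pattern (solution _ gR) x t0.
      by have [-> /u_eq ->] :=
        wave_pattern_left g1 (intermediate _ gR) pat xg.
    by split; apply: cvg_near_cst; apply: filterS left => g [].
  + rewrite -/(contact_curve beta uL t) -/(contact_curve beta uR t).
    rewrite -similarity_lt// -similarity_gt// -/xi => /andP[xiL xiR].
    (* [d] is half the distance from [xi] to the nearer of [uL] and [uR]: both bounds have limits at
       most 1 - 2 d, strictly below q = 1 - d. *)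
    pose d := Num.min (xi - uL) (uR - xi) / 2.
    have d0 : 0 < d by rewrite divr_gt0// lt_min !subr_gt0 xiL.
    have [dL dR] : d * 2 <= xi - uL /\ d * 2 <= uR - xi.
      by rewrite divfK//; split; rewrite ge_min lexx ?orbT.
    apply: (cvg0_powR_half_le (q := 1 - d)); first by lra.
    have bound := near_fan_bound rhoL_gt0 rhoR_gt0 (uL := uL) (uR := uR)
      (xi := xi) (q := 1 - d).
    near=> g; have gR : two_rarefaction_range rhoL uL rhoR uR g by near: g.
    have g1 : 1 < g by near: g.
    have xg : mu1 g rhoL uL < xi < mu2 g rhoR uR.
      apply/andP; split; near: g.
        exact: cvgr_lt (cvg_mu1_at1 rhoL_gt0) _ xiL.
      exact: cvgr_gt (cvg_mu2_at1 rhoR_gt0) _ xiR.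
    have pat := trs_pattern (solution _ gR) x t0.
    have [r0 rle] :=
        wave_pattern_fan g1 (intermediate _ gR) pat xg.
    split=> //; apply: (le_trans rle); near: g.
    by apply: bound; apply/andP; split; lra.
  + rewrite -/(contact_curve beta uR t) -similarity_gt// -/xi => xiR.
    have right : \forall g \near 1^'+,
        rho g t x = rhoR /\ u g t x = uR + beta * t.
      near=> g; have gR : two_rarefaction_range rhoL uL rhoR uR g by near: g.
      have g1 : 1 < g by near: g.
      have xg : mu2 g rhoR uR < xi.
        by near: g; exact: cvgr_lt (cvg_mu2_at1 rhoR_gt0) _ xiR.
      have pat := trs_pattern (solution _ gR) x t0.
      by have [-> /u_eq ->] :=
        wave_pattern_right g1 (intermediate _ gR) pat xg.
    by split; apply: cvg_near_cst; apply: filterS right => g [].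
Unshelve. all: by end_near. Qed.
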